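(* Let $m$ be a positive integer and let $\alpha=(\alpha_{k+m})_{k\in\mathbb N}$ be a sequence of commuting indeterminates. Let $\mathrm S^{(m)}=\left(S^{(m)}_{n,k}(\alpha)\right)_{n,k\in\mathbb N}$ and $\hat{\mathrm S}^{(m)}=\left(S^{(m;j)}_{n}(\alpha)\right)_{n,j\in\mathbb N}$ be the (infinite) matrices of generalised and of modified $m$-Stieltjes-Rogers polynomials, respectively. Then $$\hat{\mathrm S}^{(m)}=\mathrm S^{(m)}\,\Lambda^{(m)},$$ where $\Lambda^{(m)}=\left(\lambda^{(m)}_{i,j}\right)_{i,j\in\mathbb N}$ is the upper-triangular matrix such that $\lambda^{(m)}_{i,j}$ is the generating polynomial of the partial $m$-Dyck paths from $(0,(m+1)i)$ to $(j,j)$. Therefore, $\lambda^{(m)}_{0,j}=1$ for any $j\in\mathbb N$ and $$\lambda^{(m)}_{i,j}=\sum_{j\geq\ell_1\geq\cdots\geq\ell_i\geq i}\ \prod_{k=1}^{i}\alpha_{km+\ell_k}=\sum_{\ell_1=i}^{j}\alpha_{m+\ell_1}\sum_{\ell_2=i}^{\ell_1}\alpha_{2m+\ell_2}\cdots\sum_{\ell_i=i}^{\ell_{i-1}}\alpha_{im+\ell_i}\qquad\text{when }1\leq i\leq j.$$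
   Context: $\mathbb N=\{0,1,2,\dots\}$. For a positive integer $m$, a partial $m$-Dyck path is a finite path in $\mathbb N\times\mathbb N$ using steps $(1,1)$ (rises) and $(1,-m)$ ($m$-falls), allowed to start and end anywhere in $\mathbb N\times\mathbb N$. Given a sequence $\alpha=(\alpha_i)_{i\ge m}$, each rise gets weight $1$ and each $m$-fall from height $i$ (i.e. starting at a point with second coordinate $i$) gets weight $\alpha_i$; the weight of a path is the product of the weights of its steps, and the generating polynomial of a finite set of paths is the sum of their weights. The generalised $m$-Stieltjes-Rogers polynomial $S^{(m)}_{n,k}(\alpha)$ is the generating polynomial of the partial $m$-Dyck paths from $(0,0)$ to $((m+1)n,(m+1)k)$. The modified $m$-Stieltjes-Rogers polynomial of type $j$, $S^{(m;j)}_{n}(\alpha)$, is the generating polynomial of the partial $m$-Dyck paths from $(0,0)$ to $((m+1)n+j,j)$. *)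

(* Defs.v *)
From HB Require Import structures.
From mathcomp Require Import all_boot all_order all_algebra.

Set Implicit Arguments.
Unset Strict Implicit.
Unset Printing Implicit Defensive.

Import GRing.Theory.
Local Open Scope ring_scope.

(* A partial m-Dyck path is encoded by its starting point in N x N and the    *)
(* word of its steps: [true] is the rise (1,1), [false] the m-fall (1,-m).    *)
(* The subtraction is truncated, so the guard [m <= P.2] is what keeps the    *)
(* path inside N x N.                                                         *)
Fixpoint dyck_path (m : nat) (P Q : nat * nat) (w : seq bool) : bool :=
  match w with
  | [::] => P == Q
  | true :: w' => dyck_path m (P.1.+1, P.2.+1) Q w'
  | false :: w' => (m <= P.2)%N && dyck_path m (P.1.+1, (P.2 - m)%N) Q w'
  end.

(* Only the values [alpha h] with [m <= h] matter on a partial m-Dyck path.   *)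
Fixpoint path_weight (R : comNzRingType) (m : nat) (alpha : nat -> R)
    (h : nat) (w : seq bool) : R :=
  match w with
  | [::] => 1
  | true :: w' => path_weight m alpha h.+1 w'
  | false :: w' => alpha h * path_weight m alpha (h - m)%N w'
  end.

(* Every step moves the abscissa by 1, hence every path from P to Q has       *)
(* exactly Q.1 - P.1 steps (and there is none when Q.1 < P.1).                *)
Lemma size_dyck_path (m : nat) (P Q : nat * nat) (w : seq bool) :
  dyck_path m P Q w -> (P.1 + size w)%N = Q.1.
Proof.
elim: w P => [|[] w IHw] P /=; first by move/eqP<-; rewrite addn0.
  by move/IHw; rewrite addSnnS.
by case/andP=> _ /IHw; rewrite addSnnS.
Qed.

Definition path_gen (R : comNzRingType) (m : nat) (alpha : nat -> R)
    (P Q : nat * nat) : R :=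
  \sum_(w : (Q.1 - P.1).-tuple bool | dyck_path m P Q w)
    path_weight m alpha P.2 w.

Definition stieltjes_rogers (R : comNzRingType) (m : nat) (alpha : nat -> R)
    (n k : nat) : R :=
  path_gen m alpha (0, 0)%N (m.+1 * n, m.+1 * k)%N.

Definition modified_stieltjes_rogers (R : comNzRingType) (m : nat)
    (alpha : nat -> R) (n j : nat) : R :=
  path_gen m alpha (0, 0)%N (m.+1 * n + j, j)%N.

Definition lambda (R : comNzRingType) (m : nat) (alpha : nat -> R)
    (i j : nat) : R :=
  path_gen m alpha (0, m.+1 * i)%N (j, j).

(* C is the product of the N x N matrices A and B: each of the sums           *)
(* sum_k A n k * B k j has finitely many nonzero terms, and its value is      *)
(* C n j.                                                                     *)
Definition is_infmx_product (R : comNzRingType) (A B C : nat -> nat -> R) :=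
  forall n j : nat, exists N : nat,
    (forall k : nat, (N <= k)%N -> A n k * B k j = 0) /\
    C n j = \sum_(k < N) A n k * B k j.

(* Sum over j >= l_1 >= ... >= l_i >= i; the entry l_k of the mathematical    *)
(* formula is [tnth l (k - 1)].                                               *)
Definition chain_sum (R : comNzRingType) (m : nat) (alpha : nat -> R)
    (i j : nat) : R :=
  \sum_(l : i.-tuple 'I_j.+1 | path geq j (rcons (map val l) i))
    \prod_(k < i) alpha (k.+1 * m + tnth l k)%N.

(* The r innermost sums, the outermost of them being over i <= l_k <= u.      *)
Fixpoint nested_sum_from (R : comNzRingType) (m : nat) (alpha : nat -> R)
    (i r k u : nat) : R :=
  match r with
  | 0 => 1
  | r'.+1 => \sum_(i <= l < u.+1)
               alpha (k * m + l)%N * nested_sum_from m alpha i r' k.+1 l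
  end.

Definition nested_sum (R : comNzRingType) (m : nat) (alpha : nat -> R)
    (i j : nat) : R :=
  nested_sum_from m alpha i i 1 j.

(* Main.v *)
(** A path from (0,0) to ((m+1)n+j, j) is cut at abscissa (m+1)n: its height
    there is congruent to (m+1)n, hence to 0, modulo m+1, which gives the matrix
    product.  A path from (0,(m+1)i) to (j,j) has exactly i falls; reading them
    backwards from the end of the path, the k-th one starts at height km + l_k
    with l_k = i + (number of preceding rises), so l_1 >= ... >= l_i and
    i <= l_k <= j. *)
Require Import Defs.
From HB Require Import structures.
From mathcomp Require Import all_boot all_order all_algebra zify.

Set Implicit Arguments.
Unset Strict Implicit.
Unset Printing Implicit Defensive.

Import GRing.Theory.
Local Open Scope ring_scope.

(** [P] and [F] live on plain sequences, so that recursive ones compute on [x :: w]. *)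
Lemma sum_tuple_cons (V : nmodType) (T : finType) (n : nat)
    (P : pred (seq T)) (F : seq T -> V) :
  \sum_(w : n.+1.-tuple T | P w) F w =
  \sum_(x : T) \sum_(w : n.-tuple T | P (x :: w)) F (x :: w).
Proof.
rewrite (pair_big_dep xpredT (fun x (w : n.-tuple T) => P (x :: w))
  (fun x (w : n.-tuple T) => F (x :: w))) /=.
rewrite (reindex (fun p : T * n.-tuple T => [tuple of p.1 :: p.2])) //=.
exists (fun w => (thead w, [tuple of behead w])) => [[x w]|w] _ /=.
  by rewrite theadE; congr pair; apply: val_inj.
by rewrite -tuple_eta.
Qed.

Lemma sum_tuple0 (V : nmodType) (T : finType) (P : pred (seq T))
    (F : seq T -> V) :
  \sum_(w : 0.-tuple T | P w) F w = if P [::] then F [::] else 0.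
Proof.
rewrite big_mkcond (bigD1 [tuple]) //= big1 ?addr0 // => w.
by case/eqP; rewrite [w]tuple0.
Qed.

Section HeightGen.

Variables (R : comNzRingType) (m : nat) (alpha : nat -> R).

(* First-step recursion for the paths with N steps from height h to height q:
   path generating polynomials are invariant under horizontal translation. *)
Fixpoint height_gen (h N q : nat) : R :=
  match N with
  | 0 => (h == q)%:R
  | N'.+1 => height_gen h.+1 N' q +
      (if (m <= h)%N then alpha h * height_gen (h - m) N' q else 0)
  end.

(** The abscissa [x] is general because the induction advances it. *)
Lemma sum_dyck_path (x h N q : nat) :
  \sum_(w : N.-tuple bool | dyck_path m (x, h) (x + N, q)%N w)
    path_weight m alpha h w = height_gen h N q.
Proof.
elim: N x h => [|N IHN] x h.
  rewrite (sum_tuple0 (dyck_path m (x, h) _) (path_weight m alpha h)) /=.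
  by rewrite addn0 xpair_eqE eqxx /=; case: eqP.
rewrite (sum_tuple_cons _ (dyck_path m (x, h) _) (path_weight m alpha h)) /=.
rewrite big_bool /= -addSnnS IHN; congr (_ + _).
case: leqP => _ /=; last by rewrite big_pred0_eq.
by rewrite -mulr_sumr IHN.
Qed.

Lemma path_gen0 (h N q : nat) :
  path_gen m alpha (0, h)%N (N, q) = height_gen h N q.
Proof. by rewrite /path_gen /= subn0 -(sum_dyck_path 0). Qed.

(** Paths are sorted by the height [k] reached after [M] steps, which is at most [h + M]. *)
Lemma height_gen_cat (h M N q B : nat) : (h + M < B)%N ->
  height_gen h (M + N) q =
  \sum_(k < B) height_gen h M k * height_gen k N q.
Proof.
elim: M h => [|M IHM] h ltB /=.
  rewrite addn0 in ltB; rewrite (bigD1 (Ordinal ltB)) //= eqxx mul1r big1 ?addr0 //.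
  by move=> k; rewrite eq_sym -val_eqE /= => /negPf->; rewrite mul0r.
under eq_bigr do rewrite mulrDl.
rewrite big_split /= -IHM; last by lia.
congr (_ + _); case: leqP => [le_mh|_].
  rewrite IHM; last by lia.
  by rewrite mulr_sumr; apply: eq_bigr => k _; rewrite mulrA.
by rewrite big1 // => k _; rewrite mul0r.
Qed.

(** Last-step recursion: the path arrives by a rise from [q - 1] or by a fall from [q + m]. It
    serves to read the falls backwards. *)
Lemma height_genSr (h N q : nat) :
  height_gen h N.+1 q =
  (if q is q'.+1 then height_gen h N q' else 0) +
  alpha (q + m)%N * height_gen h N (q + m).
Proof.
elim: N h => [|N IHN] h.
  rewrite /=; congr (_ + _); first by case: q.
  case: leqP => [le_mh|lt_hm].
    have ->: (h - m == q)%N = (h == q + m)%N by lia.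
    by case: eqP => [->|_] //; rewrite !mulr0.
  have ->: (h == q + m)%N = false by lia.
  by rewrite mulr0.
rewrite [LHS]/= -/(height_gen h.+1 N.+1 q) -/(height_gen (h - m) N.+1 q) !IHN.
case: q {IHN} => [|q] /=; case: leqP => _;
  by rewrite ?mulrDr ?mulr0 ?addr0 ?add0r ?(mulrCA (alpha h)) // addrACA.
Qed.

Lemma height_gen_eq0_gt (h N q : nat) : (h + N < q)%N -> height_gen h N q = 0.
Proof.
elim: N h => [|N IHN] h lt_q /=; first by have ->: (h == q) = false by lia.
by rewrite !IHN ?mulr0 ?if_same ?addr0 //; lia.
Qed.

Lemma height_gen_eq0_lt (h N q : nat) :
  (q + m * N < h)%N -> height_gen h N q = 0.
Proof.
elim: N h => [|N IHN] h lt_q /=; first by have ->: (h == q) = false by lia.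
by rewrite !IHN ?mulr0 ?if_same ?addr0 //; lia.
Qed.

(** Modulo [m + 1], a rise and an [m]-fall both add 1 to the height. *)
Lemma height_gen_eq0_mod (h N q : nat) :
  h + N != q %[mod m.+1] -> height_gen h N q = 0.
Proof.
elim: N h => [|N IHN] h neq_q /=.
  by case: (h =P q) neq_q => [->|//]; rewrite addn0 eqxx.
rewrite IHN ?addSnnS // add0r; case: leqP => // le_mh.
rewrite IHN ?mulr0 //; apply: contra neq_q => /eqP <-.
by rewrite -(modnDr (h - m + N)); apply/eqP; congr modn; lia.
Qed.

(* Induction on the last step: a rise lowers the upper bound u = i + t of the
   outermost sum; a fall ending at height m s + u starts at height m (s + 1) + u
   and is the term l = u of that sum. *)
Lemma height_gen_nested (i r s t : nat) : (r + s = i)%N ->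
  height_gen (m.+1 * i) (t + r) (m * s + i + t) =
  nested_sum_from m alpha i r s.+1 (i + t).
Proof.
elim: {t r}(t + r)%N {-2}t {-2}r s (erefl (t + r)%N) => [|N IHN] t r s.
  move=> trN rs; have [-> ->]: t = 0%N /\ r = 0%N by lia.
  by rewrite /=; have ->: (m.+1 * i == m * s + i + 0)%N by lia.
move=> trN rs; rewrite trN height_genSr.
have rise t' : t = t'.+1 -> height_gen (m.+1 * i) N (m * s + i + t') =
    nested_sum_from m alpha i r s.+1 (i + t').
  by move=> tE; rewrite -IHN //; [congr height_gen; lia | lia].
case: r => [|r] in trN rs rise *.
  case: t => [|t] in trN rise *; first by lia.
  (* No fall is left: a final one would start higher than [N] rises can reach. *)
  rewrite addnS rise // (@height_gen_eq0_gt _ _ ((m * s + i + t).+1 + m)).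
    by rewrite mulr0 addr0.
  by lia.
have fall :
    alpha (m * s + i + t + m)%N *
      height_gen (m.+1 * i) N (m * s + i + t + m) =
    alpha (s.+1 * m + (i + t))%N * nested_sum_from m alpha i r s.+2 (i + t).
  rewrite -IHN; [|lia|lia].
  congr (alpha _ * height_gen _ _ _); lia.
rewrite fall [RHS]/= big_nat_recr /=; last by lia.
congr (_ + _); case: t => [|t] in trN rise fall *.
  (* No rise is left: even [N] falls end above the height [q] from which a final rise would
     start. *)
  rewrite !addn0 big_geq //; case E: (m * s + i)%N => [//|q].
  by apply: height_gen_eq0_lt; lia.
by rewrite addnS rise // addnS.
Qed.

Lemma lambda_eq0 (i j : nat) : (j < i)%N -> lambda m alpha i j = 0.
Proof. by move=> lt_ji; rewrite /lambda path_gen0 height_gen_eq0_lt //; nia. Qed.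

(** The [j] steps are [i] falls and [j - i] rises: the case [r = i], [s = 0], [t = j - i] of
    [height_gen_nested]. *)
Lemma lambda_nested (i j : nat) :
  (i <= j)%N -> lambda m alpha i j = nested_sum m alpha i j.
Proof.
move=> le_ij; rewrite /lambda path_gen0 /nested_sum -{3}(subnKC le_ij).
by rewrite -height_gen_nested ?addn0 // muln0 add0n subnKC // subnK.
Qed.

(** The head of the chain is the outermost index; peeling it off makes it the new bound [u] and
    shifts [k]. *)
Lemma chain_sum_from (i j r k u : nat) : (i <= u <= j)%N ->
  \sum_(l : r.-tuple 'I_j.+1 | path geq u (rcons (map val l) i))
    \prod_(t < r) alpha ((k + t) * m + nth ord0 l t)%N =
  nested_sum_from m alpha i r k u.
Proof.
elim: r k u => [|r IHr] k u /andP[le_iu le_uj].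
  rewrite (sum_tuple0 (fun l : seq 'I_j.+1 => path geq u (rcons (map val l) i))
    (fun l => \prod_(t < 0) alpha ((k + t) * m + nth ord0 l t)%N)) /=.
  by rewrite le_iu big_ord0.
rewrite (sum_tuple_cons _ (fun l : seq 'I_j.+1 => path geq u (rcons (map val l) i))
    (fun l => \prod_(t < r.+1) alpha ((k + t) * m + nth ord0 l t)%N)) /=.
rewrite big_geq_mkord (big_ord_widen_cond j.+1 (leq i)
  (fun l => alpha (k * m + l)%N * nested_sum_from m alpha i r k.+1 l)) //.
rewrite [RHS]big_mkcond; apply: eq_bigr => x _ /=.
case: (leqP x u) => [le_xu|lt_ux] /=; last first.
  by rewrite ltnS (leqNgt x) lt_ux andbF big_pred0_eq.
rewrite ltnS le_xu andbT; case: leqP => [le_ix|lt_xi].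
  rewrite -IHr ?le_ix ?(leq_trans le_xu) // mulr_sumr.
  apply: eq_bigr => l _; rewrite big_ord_recl addn0 /=; congr (_ * _).
  by apply: eq_bigr => t _; rewrite addSnnS.
(* A chain decreasing from [x] to its last entry [i] would force [i <= x]. *)
apply: big_pred0 => l; apply/negP.
rewrite path_sortedE; last by move=> a b c /= ba cb; apply: leq_trans ba.
by case/andP => /allP/(_ i); rewrite mem_rcons mem_head /= leqNgt lt_xi => /(_ isT).
Qed.

Lemma chain_sum_nested (i j : nat) :
  (i <= j)%N -> chain_sum m alpha i j = nested_sum m alpha i j.
Proof.
move=> le_ij; rewrite /nested_sum -(@chain_sum_from i j) ?le_ij ?leqnn //.
apply: eq_bigr => l _; apply: eq_bigr => t _.
by rewrite add1n (tnth_nth ord0).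
Qed.

Lemma modified_stieltjes_rogersE (n j N : nat) : (n < N)%N ->
  modified_stieltjes_rogers m alpha n j =
  \sum_(k < N) stieltjes_rogers m alpha n k * lambda m alpha k j.
Proof.
move=> lt_nN; rewrite /modified_stieltjes_rogers path_gen0.
(* This bound exceeds the maximal height [m.+1 * n] and cuts the heights into [N] blocks of length
   [m + 1]; by congruence only the first height of each block contributes. *)
rewrite (@height_gen_cat _ _ _ _ (N * m.+1)); last by nia.
rewrite -(big_mkord xpredT (fun k =>
  height_gen 0 (m.+1 * n) k * height_gen k j j)) big_nat_mul big_mkord.
apply: eq_bigr => k _; rewrite big_ltn; last by nia.
rewrite /stieltjes_rogers /lambda !path_gen0 (mulnC k) big_nat big1.
  by rewrite /= addr0.
move=> l lbnd; rewrite height_gen_eq0_mod ?mul0r // add0n modnMr.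
apply/eqP => /esym/eqP; rewrite -/(dvdn _ _) => /dvdnP[c lE].
by move: lbnd; rewrite lE (mulnC c) (mulnC k.+1) !ltn_pmul2l // ltnS
  (leqNgt c) andbN.
Qed.

End HeightGen.

Theorem proposition3p1 (R : comNzRingType) (m : nat) (m_gt0 : (0 < m)%N)
    (alpha : nat -> R) :
  [/\ is_infmx_product (stieltjes_rogers m alpha) (lambda m alpha)
        (modified_stieltjes_rogers m alpha),
      forall i j : nat, (j < i)%N -> lambda m alpha i j = 0,
      forall j : nat, lambda m alpha 0 j = 1
    & forall i j : nat, (1 <= i <= j)%N ->
        lambda m alpha i j = chain_sum m alpha i j /\
        chain_sum m alpha i j = nested_sum m alpha i j].
Proof.
split=> [n j|i j|j|i j /andP[_ le_ij]].
(* After [m.+1 * n] steps the height is at most [m.+1 * n], so columns [k > n] vanish. *)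
- exists n.+1; split; last exact: modified_stieltjes_rogersE.
  move=> k lt_nk; rewrite /stieltjes_rogers path_gen0 height_gen_eq0_gt ?mul0r //.
  by rewrite add0n ltn_pmul2l.
- exact: lambda_eq0.
(* For [i = 0] the nested sum has no level and computes to 1. *)
- exact: lambda_nested.
- by rewrite lambda_nested // chain_sum_nested.
Qed.
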